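(* Let $A\in\mathbb{R}^{n\times n}$ and $B\in\mathbb{R}^{n\times 1}$ be such that $(A,B)$ is controllable, let $S=[A^{n-1}B\ \ A^{n-2}B\ \cdots\ B]\in\mathbb{R}^{n\times n}$ (which is invertible), and let the control gain be $$K_{db}=[1\ 0\ \cdots\ 0]\,S^{-1}A^n\in\mathbb{R}^{1\times n}.$$ Then all eigenvalues of $A-BK_{db}$ are zero, and for every initial state $x(0)\in\mathbb{R}^n$ the state of the closed-loop system $x(k+1)=Ax(k)+Bu(k)$ with $u(k)=-K_{db}x(k)$ satisfies $x(k)=0$ for all $k>n$.
   Context: The system is a discrete-time single-input linear system with $x(k)\in\mathbb{R}^n$, $u(k)\in\mathbb{R}$, $k=0,1,2,\dots$, without constraints on states or controls. *)

(* Defs.v *)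
From mathcomp Require Import all_boot all_order all_algebra.
From mathcomp Require Import reals complex.
Set Implicit Arguments.
Unset Strict Implicit.
Unset Printing Implicit Defensive.
Import GRing.Theory.
Local Open Scope ring_scope.

(* [x] is a state trajectory of x(k+1) = A x(k) + B u(k) under the scalar input
   sequence [u]; a scalar input u(k) is encoded as a 1 x 1 matrix. *)
Definition trajectory (R : realType) (n : nat) (A : 'M[R]_n) (B : 'cV[R]_n)
    (u : nat -> 'cV[R]_1) (x : nat -> 'cV[R]_n) : Prop :=
  forall k : nat, x k.+1 = A *m x k + B *m u k.

(* Every state can be steered to every state (not merely to the origin, which
   in discrete time is strictly weaker when A is singular) in finitely many
   steps by some input sequence. *)
Definition controllable (R : realType) (n : nat) (A : 'M[R]_n) (B : 'cV[R]_n)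
    : Prop :=
  forall x0 x1 : 'cV[R]_n,
    exists (N : nat) (u : nat -> 'cV[R]_1) (x : nat -> 'cV[R]_n),
      [/\ trajectory A B u x, x 0%N = x0 & x N = x1].

Definition ctrb_mx (R : realType) (n : nat) (A : 'M[R]_n) (B : 'cV[R]_n)
    : 'M[R]_n :=
  \matrix_(i < n, j < n) (A ^+ (n.-1 - j) *m B) i 0.

Definition e1_row (R : realType) (n : nat) : 'rV[R]_n :=
  \row_(j < n) (nat_of_ord j == 0%N)%:R.

Definition deadbeat_gain (R : realType) (n : nat) (A : 'M[R]_n) (B : 'cV[R]_n)
    : 'rV[R]_n :=
  e1_row R n *m invmx (ctrb_mx A B) *m A ^+ n.

(* A real matrix may have non-real eigenvalues, so they are taken in R[i].
   The library's [eigenvalue] refers to row eigenvectors; for a square matrix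
   these have the same eigenvalues as column eigenvectors. *)
Definition complex_eigenvalue (R : realType) (n : nat) (M : 'M[R]_n)
    (l : complex R) : bool :=
  eigenvalue (map_mx (real_complex R) M) l.

(* Main.v *)
Require Import Defs.
From mathcomp Require Import all_boot all_order all_algebra.
From mathcomp Require Import reals complex.
Set Implicit Arguments.
Unset Strict Implicit.
Unset Printing Implicit Defensive.
Import GRing.Theory.
Local Open Scope ring_scope.

(** Let [S = ctrb_mx A B], [M = A - B K] with [K = deadbeat_gain A B], and let
    [q] be the first row of [S^-1], so that [K = q A^n].

    The matrix [S] is invertible because a row vector [w] with [w S = 0]
    kills [A^k B] for [k < n], hence for every [k] by Cayley-Hamilton, hence
    every state reachable from the origin; controllability then forces [w = 0].

    Everything else follows from [M^n = 0].  By definition of [q], the scalar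
    [q A^p B] is [1] for [p = n - 1] and [0] for [p < n - 1]: in control terms,
    [q x] is a flat output, which the input reaches only after [n] steps.  Hence
    [q A^p M = q A^(p+1) - (q A^p B) q A^n] equals [q A^(p+1)] for [p < n - 1]
    and [0] for [p = n - 1].  Thus [M] acts as a nilpotent shift on the rows
    [q, q A, ..., q A^(n-1)], all of which are killed by [M^n].  These rows form
    a basis, because stacking them into [O] makes [O S] unitriangular; hence
    [M^n = 0].  Then an eigenvalue [l] of [M] satisfies [l^n = 0], and the
    closed-loop state [x k = M^k x 0] vanishes from time [n] on. *)

(** Modulo its characteristic polynomial, a power of [A] is a combination of
    the first [n] ones. *)
Lemma mul_expmx_eq0 (F : fieldType) (n : nat) (A : 'M[F]_n) (B : 'cV[F]_n)
    (w : 'rV[F]_n) :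
  (forall k, (k < n)%N -> w *m (A ^+ k *m B) = 0) ->
  forall k, w *m (A ^+ k *m B) = 0.
Proof.
case: n A B w => [|n] A B w w0 k; first by rewrite thinmx0 mul0mx.
have -> : A ^+ k = horner_mx A ('X^k %% char_poly A).
  transitivity (horner_mx A 'X^k); first by rewrite rmorphXn /= horner_mx_X.
  rewrite [in LHS](divp_eq 'X^k (char_poly A)) rmorphD rmorphM /=.
  by rewrite Cayley_Hamilton mulr0 add0r.
set r := _ %% _.
have szr : (size r <= n.+1)%N.
  rewrite -ltnS -(size_char_poly A) ltn_modp.
  exact/monic_neq0/char_poly_monic.
rewrite -[r]coefK poly_def rmorph_sum /= mulmx_suml mulmx_sumr big1 // => i _.
rewrite linearZ /= rmorphXn /= horner_mx_X -scalemxAl -scalemxAr w0 ?scaler0 //.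
exact: leq_trans szr.
Qed.

Lemma reachable_mul_eq0 (R : realType) (n : nat) (A : 'M[R]_n) (B : 'cV[R]_n)
    (w : 'rV[R]_n) (u : nat -> 'cV[R]_1) (x : nat -> 'cV[R]_n) :
  (forall k, w *m (A ^+ k *m B) = 0) -> trajectory A B u x -> x 0%N = 0 ->
  forall N, w *m x N = 0.
Proof.
move=> w0 xtraj x0 N.
(* The rows [w A^j] have to be treated together for the induction to work. *)
suff /(_ 0%N) : forall j, w *m (A ^+ j *m x N) = 0 by rewrite expr0 mul1mx.
elim: N => [|N IHN] j; first by rewrite x0 !mulmx0.
rewrite xtraj !mulmxDr (mulmxA _ A) mulmxE -exprSr IHN add0r.
by rewrite !mulmxA -(mulmxA w) w0 mul0mx.
Qed.

Lemma col_ctrb_mx (R : realType) (n : nat) (A : 'M[R]_n) (B : 'cV[R]_n) j :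
  col j (ctrb_mx A B) = A ^+ (n.-1 - j) *m B.
Proof. by apply/colP => i; rewrite !mxE. Qed.

Lemma col_ctrb_mx_rev (R : realType) (n : nat) (A : 'M[R]_n) (B : 'cV[R]_n)
    (p : 'I_n) :
  col (rev_ord p) (ctrb_mx A B) = A ^+ p *m B.
Proof.
case: n A B p => [|n] A B p; first by case: p.
by rewrite col_ctrb_mx /= subSS subKn // -ltnS.
Qed.

Lemma ctrb_mx_unit (R : realType) (n : nat) (A : 'M[R]_n) (B : 'cV[R]_n) :
  controllable A B -> ctrb_mx A B \in unitmx.
Proof.
move=> ctrAB; rewrite -row_free_unit -kermx_eq0; apply/rowV0P => w.
move=> /sub_kermxP wS.
have w0 : forall k, w *m (A ^+ k *m B) = 0.
  apply: mul_expmx_eq0 => k ltkn.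
  by rewrite -(col_ctrb_mx_rev A B (Ordinal ltkn)) colE mulmxA wS mul0mx.
apply/rowP => i; have [N [u [x [xtraj x0 xN]]]] := ctrAB 0 (delta_mx i 0).
have := reachable_mul_eq0 w0 xtraj x0 N.
by rewrite xN -colE => /colP/(_ 0); rewrite !mxE.
Qed.

(** The rows of the inverse are dual to the columns of the controllability
    matrix, whose first column is [A^(n-1) B]. *)
Lemma flat_row_ctrb (R : realType) (n : nat) (A : 'M[R]_n) (B : 'cV[R]_n) p :
  ctrb_mx A B \in unitmx -> (p < n)%N ->
  e1_row R n *m invmx (ctrb_mx A B) *m (A ^+ p *m B) = (p == n.-1)%:R%:M.
Proof.
case: n A B => [|n] A B // uS ltpn.
rewrite -(col_ctrb_mx_rev A B (Ordinal ltpn)) colE mulmxA mulmxKV // -colE.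
apply/rowP => i; rewrite !ord1 !mxE mulr1n /= subSS.
by rewrite subn_eq0 eqn_leq -[(p <= n)%N]ltnS ltpn.
Qed.

(** The feedback turns [A] into a nilpotent shift on the rows [q A^p], and the
    triangularity of their products with the controllability matrix makes
    these rows a basis. *)
Lemma deadbeat_nilpotent (R : realType) (n : nat) (A : 'M[R]_n)
    (B : 'cV[R]_n) :
  ctrb_mx A B \in unitmx -> (A - B *m deadbeat_gain A B) ^+ n = 0.
Proof.
case: n A B => [|n] A B uS; first by rewrite thinmx0.
rewrite /deadbeat_gain.
have qAB p := @flat_row_ctrb R n.+1 A B p uS.
set q := e1_row R n.+1 *m _ in qAB *; set M := A - _.
have qAM p : (p <= n)%N -> q *m A ^+ p *m M = (p != n)%:R *: (q *m A ^+ p.+1).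
  move=> lepn; rewrite mulmxBr -(mulmxA q _ A) mulmxE -exprSr.
  rewrite !mulmxA -(mulmxA q _ B) qAB // -!mulmxA mul_scalar_mx.
  by case: eqP => [->|_]; rewrite ?scale0r ?subr0 ?scale1r ?subrr.
have qM p : (p <= n)%N -> q *m M ^+ p = q *m A ^+ p.
  elim: p => [|p IHp] // ltpn; rewrite exprSr -mulmxE mulmxA IHp ?(ltnW ltpn) //.
  by rewrite qAM ?(ltnW ltpn) // (ltn_eqF ltpn) scale1r.
have qMn : q *m M ^+ n.+1 = 0.
  by rewrite exprSr -mulmxE mulmxA qM // qAM // eqxx scale0r.
pose O := \matrix_(i < n.+1) (q *m A ^+ i).
have OS i j : (O *m ctrb_mx A B) i j = (q *m (A ^+ (i + (n - j)) *m B)) 0 0.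
  have -> : (O *m ctrb_mx A B) i j = (row i O *m col j (ctrb_mx A B)) 0 0.
    by rewrite !mxE; apply: eq_bigr => k _; rewrite !mxE.
  by rewrite rowK col_ctrb_mx exprD -mulmxE !mulmxA.
have uO : O \in unitmx.
  suff : O *m ctrb_mx A B \in unitmx by rewrite unitmx_mul => /andP[].
  rewrite unitmxE det_trig.
    rewrite big1 ?unitr1 // => i _.
    by rewrite OS subnKC -1?ltnS // qAB // eqxx !mxE.
  apply/is_trig_mxP => i j ltij; rewrite OS.
  have lts : (i + (n - j) < n)%N.
    have lejn : (j <= n)%N by rewrite -ltnS.
    by rewrite -[X in (_ < X)%N](subnKC lejn) ltn_add2r.
  by rewrite qAB ?ltnS ?(ltnW lts) // (ltn_eqF lts) !mxE mul0rn.
apply: (can_inj (mulKmx uO)); rewrite mulmx0; apply/row_matrixP => i.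
(* [M^i] and [M^n] commute, so killing [q] is enough to kill [q A^i = q M^i]. *)
rewrite row_mul rowK row0 -qM -1?ltnS // -mulmxA mulmxE -exprD addnC exprD.
by rewrite -mulmxE mulmxA qMn mul0mx.
Qed.

Lemma nilpotent_eigenvalue (F : fieldType) (n m : nat) (M : 'M[F]_n) l :
  M ^+ m = 0 -> eigenvalue M l -> l = 0.
Proof.
move=> M0 /eigenvalueP[v vM v_neq0].
have vMk k : v *m M ^+ k = l ^+ k *: v.
  elim: k => [|k IHk]; first by rewrite mulmx1 scale1r.
  by rewrite exprSr -mulmxE mulmxA IHk -scalemxAl vM scalerA -exprSr.
have /esym/eqP := vMk m.
rewrite M0 mulmx0 scaler_eq0 (negPf v_neq0) orbF expf_eq0.
by case/andP=> _ /eqP.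
Qed.

Theorem theorem2 (R : realType) (n : nat) (hn : (0 < n)%N)
    (A : 'M[R]_n) (B : 'cV[R]_n) (hAB : controllable A B) :
  [/\ ctrb_mx A B \in unitmx,
      forall l : complex R,
        complex_eigenvalue (A - B *m deadbeat_gain A B) l -> l = 0
    & forall (x : nat -> 'cV[R]_n) (u : nat -> 'cV[R]_1),
        trajectory A B u x ->
        (forall k : nat, u k = - deadbeat_gain A B *m x k) ->
        forall k : nat, (n < k)%N -> x k = 0].
Proof.
have uS := ctrb_mx_unit hAB; have Mn := deadbeat_nilpotent uS.
split=> // [l|x u xtraj uE k ltnk].
  apply: (@nilpotent_eigenvalue _ _ n).
  have map_exp (C : 'M[R]_n) j :
      map_mx (real_complex R) (C ^+ j) = map_mx (real_complex R) C ^+ j.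
    elim: j => [|j IHj]; first by rewrite map_mx1.
    by rewrite !exprS -!mulmxE map_mxM IHj.
  by rewrite -map_exp Mn map_mx0.
have xE j : x j = (A - B *m deadbeat_gain A B) ^+ j *m x 0%N.
  elim: j => [|j IHj]; first by rewrite mul1mx.
  by rewrite exprS -mulmxE -mulmxA -IHj xtraj uE mulmxBl mulNmx mulmxN mulmxA.
by rewrite xE -(subnK (ltnW ltnk)) exprD Mn mulr0 mul0mx.
Qed.
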